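(* Let $G$ be a finite group. Then the power semiring $\mathcal{P}(G)$ is nonfinitely based if and only if $|G|\geq 3$.
   Context: An additively idempotent semiring (ai-semiring) is an algebra $(S,+,\cdot)$ with two binary operations (no constants in the signature) such that $(S,+)$ is a commutative idempotent semigroup, $(S,\cdot)$ is a semigroup, and the distributive laws $x(y+z)\approx xy+xz$ and $(x+y)z\approx xz+yz$ hold. For a group $G$, the power semiring $\mathcal{P}(G)$ is the ai-semiring whose elements are all nonempty subsets of $G$, with $A+B=A\cup B$ and $A\cdot B=\{ab\mid a\in A,\ b\in B\}$. A variety is a class of algebras of the same signature defined by a set of identities (equivalently, closed under subalgebras, homomorphic images and arbitrary direct products); a set of identities defining it is an equational basis. A variety is finitely based if it has a finite equational basis, and nonfinitely based otherwise. $\mathsf{V}(A)$ denotes the variety generated by an algebra $A$. The algebra $A$ is called finitely based (nonfinitely based) if $\mathsf{V}(A)$ is finitely based (nonfinitely based). *)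

(* Defs.v *)
From Stdlib Require List.
From mathcomp Require Import all_boot all_fingroup.

Set Implicit Arguments.
Unset Strict Implicit.
Unset Printing Implicit Defensive.

Import GroupScope.

(* Carriers may be empty: the signature has no constants, so the empty algebra
   satisfies every identity and belongs to every variety; admitting it does not
   affect which sets of identities are bases of a given variety. *)
Record algebra : Type := Algebra {
  carrier :> Type;
  add_op : carrier -> carrier -> carrier;
  mul_op : carrier -> carrier -> carrier
}.

Record ai_semiring : Type := AiSemiring {
  ai_algebra :> algebra;
  ai_addA : associative (@add_op ai_algebra);
  ai_addC : commutative (@add_op ai_algebra);
  ai_addI : idempotent_op (@add_op ai_algebra);
  ai_mulA : associative (@mul_op ai_algebra);
  ai_mulDr : right_distributive (@mul_op ai_algebra) (@add_op ai_algebra);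
  ai_mulDl : left_distributive (@mul_op ai_algebra) (@add_op ai_algebra)
}.

Inductive term : Type :=
| Var (n : nat)
| Add (s t : term)
| Mul (s t : term).

Fixpoint eval (A : algebra) (v : nat -> A) (t : term) : A :=
  match t with
  | Var n => v n
  | Add s t => add_op (eval v s) (eval v t)
  | Mul s t => mul_op (eval v s) (eval v t)
  end.

Definition identity : Type := (term * term)%type.

Definition satisfies (A : algebra) (e : identity) : Prop :=
  forall v : nat -> A, eval v e.1 = eval v e.2.

Definition equational_basis (V : algebra -> Prop) (E : identity -> Prop) : Prop :=
  forall A : algebra, V A <-> (forall e, E e -> satisfies A e).

Definition is_variety (V : algebra -> Prop) : Prop :=
  exists E : identity -> Prop, equational_basis V E.

Definition variety_finitely_based (V : algebra -> Prop) : Prop :=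
  exists E : seq identity, equational_basis V (fun e => List.In e E).

Definition generated_variety (A : algebra) : algebra -> Prop :=
  fun B => forall V : algebra -> Prop, is_variety V -> V A -> V B.

Definition finitely_based (A : algebra) : Prop :=
  variety_finitely_based (generated_variety A).

Definition nonfinitely_based (A : algebra) : Prop := ~ finitely_based A.

Section PowerSemiring.

Variable gT : finGroupType.

Definition nonempty_set : Type := {A : {set gT} | A != set0}.

Lemma setU_nonempty (A B : nonempty_set) : val A :|: val B != set0.
Proof. by rewrite setU_eq0 negb_and (valP A). Qed.

Lemma mulg_nonempty (A B : nonempty_set) : val A * val B != set0.
Proof.
have /set0Pn[a aA] := valP A; have /set0Pn[b bB] := valP B.
by apply/set0Pn; exists (a * b); apply: mem_mulg.
Qed.

Definition power_algebra : algebra :=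
  @Algebra nonempty_set
    (fun A B => Sub (val A :|: val B) (setU_nonempty A B))
    (fun A B => Sub (val A * val B) (mulg_nonempty A B)).

Lemma power_addA : associative (@add_op power_algebra).
Proof. by move=> A B C; apply: val_inj; rewrite /= setUA. Qed.

Lemma power_addC : commutative (@add_op power_algebra).
Proof. by move=> A B; apply: val_inj; rewrite /= setUC. Qed.

Lemma power_addI : idempotent_op (@add_op power_algebra).
Proof. by move=> A; apply: val_inj; rewrite /= setUid. Qed.

Lemma power_mulA : associative (@mul_op power_algebra).
Proof. by move=> A B C; apply: val_inj; rewrite /= mulgA. Qed.

Lemma power_mulDr :
  right_distributive (@mul_op power_algebra) (@add_op power_algebra).
Proof. by move=> A B C; apply: val_inj; rewrite /= mulgU. Qed.

Lemma power_mulDl :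
  left_distributive (@mul_op power_algebra) (@add_op power_algebra).
Proof. by move=> A B C; apply: val_inj; rewrite /= mulUg. Qed.

Definition power_semiring : ai_semiring :=
  AiSemiring power_addA power_addC power_addI power_mulA power_mulDr power_mulDl.

End PowerSemiring.

(* Main.v *)
Require Import Defs.
From Stdlib Require List.
From Stdlib Require Import Classical ClassicalEpsilon FunctionalExtensionality.
From Stdlib Require Import PropExtensionality ProofIrrelevance.
From mathcomp Require Import all_boot all_fingroup.
From mathcomp Require Import cyclic ssralg zmodp matrix mxalgebra zify.

(** If [#|G| >= 3], then [1], [A = G \ 1] and [G] form a subsemiring of the power
    semiring, because [A * A = G]: a product of copies of [1] and [A] equals [1],
    [A] or [G] according to whether [A] occurs zero, one or more times.

    Take hyperedges of size [m = #|G|]. If every [G]-colouring of the vertices of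
    a hypergraph has a monochromatic edge, then, with
    [t = \sum_e \prod_(x in e) x], the identity [u + u t = u t] holds in the power
    semiring, as some product over an edge equals [k ^+ m = 1]. Words of vertices
    modulo having the same completions to an edge form an algebra where it fails
    at [u = 1]. If, moreover, any few edges form a forest, then this
    algebra satisfies each identity of the power semiring in few variables: only
    few edges are involved, and a word all of whose counts against the sets
    meeting each edge of a forest exactly once equal 1 must be an edge; such sets
    are the assignments of [1] and [A] to the vertices that give the value [A] to
    every edge. Such hypergraphs come from the partite amalgamation of Nesetril
    and Rodl, by induction on the size of the forests.

    For [#|G| = 2], a word lies below a term exactly when its letters occur in the
    term and it is, modulo 2, a sum of an odd number of words of the term; this
    follows from [x <= x y y] and [x y z <= x + y + z]. *)

Set Implicit Arguments.
Unset Strict Implicit.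
Unset Printing Implicit Defensive.

(** * Sparse hypergraphs that cannot be coloured *)

Lemma pigeonhole (T C : finType) (a : nat) (f : 'I_a -> C) :
  0 < #|C| -> #|C| * #|T| <= a ->
  exists2 K : T -> 'I_a, injective K & forall t1 t2, f (K t1) = f (K t2).
Proof.
move=> C0 aP; have [k kP] : exists k, #|T| <= #|[set i | f i == k]|.
  apply/existsP; apply: contraLR aP; rewrite negb_exists -ltnNge => /forallP h.
  have [c0 _] := card_gt0P C0.
  have T0 : 0 < #|T| by have := h c0; rewrite -ltnNge; apply: leq_ltn_trans.
  rewrite -[a in a < _](card_ord a) -sum1_card.
  rewrite (partition_big f xpredT) //=.
  have le k : \sum_(i < a | f i == k) 1 <= #|T|.-1.
    rewrite sum1_card; have := h k; rewrite -ltnNge -(prednK T0) ltnS.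
    by apply: leq_trans; rewrite cardsE.
  apply: (@leq_ltn_trans (\sum_(k : C) #|T|.-1)); first exact: leq_sum.
  by rewrite sum_nat_const ltn_mul2l C0 /= prednK.
exists (fun t => enum_val (widen_ord kP (enum_rank t))).
  move=> t1 t2 /enum_val_inj/(congr1 val)/= /val_inj; exact: enum_rank_inj.
move=> t1 t2.
have h j : f (@enum_val _ (mem [set i | f i == k]) j) = k.
  by have := enum_valP j; rewrite inE => /eqP.
by rewrite !h.
Qed.

(** Edges are injections of [T] rather than vertex sets, so that [partite_stage] can prescribe the
    part in which each position of an edge lies. *)
Record hypergraph (T : finType) := Hypergraph {
  vert : finType;
  edge : finType;
  inc : edge -> T -> vert;
  inc_inj : forall e, injective (inc e)
}.

Section Sparse.

Variables (T : finType) (H : hypergraph T).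

Definition shared (Q : {set edge H}) (e : edge H) (t : T) : Prop :=
  exists2 e', e' \in Q :\ e & exists t', inc e t = inc e' t'.

(* Any at most [s] edges form a forest: each subfamily has a leaf edge, glued to
   the others along at most one vertex. *)
Definition sparse (s : nat) : Prop :=
  forall Q : {set edge H}, 0 < #|Q| <= s ->
  exists2 e, e \in Q & forall t1 t2, shared Q e t1 -> shared Q e t2 -> t1 = t2.

Definition unavoidable (C : Type) : Prop :=
  forall c : vert H -> C, exists e, forall t1 t2, c (inc e t1) = c (inc e t2).

(** A version of [sparse] with a root, the vertex of [Z], counted as one more attachment. If the
    leaf [e0] is the only edge through the root, it is removed and its attachment becomes the root
    of the remaining edges. *)
Lemma sparse_avoid s (Z : vert H -> Prop) (Q : {set edge H}) :
  sparse s -> (forall x y, Z x -> Z y -> x = y) -> 0 < #|Q| <= s ->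
  exists2 e, e \in Q & forall t1 t2, shared Q e t1 \/ Z (inc e t1) ->
    shared Q e t2 \/ Z (inc e t2) -> t1 = t2.
Proof.
move=> sp; have [n] := ubnP #|Q|; elim: n => // n IHn in Q Z * => Qn Z1 Qs.
have [e0 e0Q leaf] := sp Q Qs.
have [[t0 [Zt0 nsh]]|noZ] :=
  classic (exists t0, Z (inc e0 t0) /\ ~ shared Q e0 t0); last first.
  have ZS t : Z (inc e0 t) -> shared Q e0 t.
    by move=> Zt; apply: NNPP => nsh; apply: noZ; exists t.
  exists e0 => // t1 t2 h1 h2; apply: leaf; first by case: h1 => // /ZS.
  by case: h2 => // /ZS.
have [Q0|/set0Pn[e1 e1Q]] := eqVneq (Q :\ e0) set0.
  have nosh t : ~ shared Q e0 t by case=> e'; rewrite Q0 inE.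
  exists e0 => // t1 t2 [/nosh//|z1] [/nosh//|z2].
  exact: (@inc_inj T H e0) (Z1 _ _ z1 z2).
pose Z' y := exists2 t, shared Q e0 t & y = inc e0 t.
have Q' : 0 < #|Q :\ e0| <= s.
  have := cardsD1 e0 Q; rewrite e0Q add1n => cQ.
  apply/andP; split; first by apply/card_gt0P; exists e1.
  by case/andP: Qs => _; rewrite cQ => /ltnW.
have [||e eQ eP] := IHn (Q :\ e0) Z' _ _ Q'.
- by move: Qn; rewrite (cardsD1 e0) e0Q.
- by move=> x y [t1 s1 ->] [t2 s2 ->]; rewrite (leaf _ _ s1 s2).
have [eNe0 eQ'] := setD1P eQ.
have e0e t t' : inc e t = inc e0 t' -> shared Q e0 t'.
  by move=> h; exists e; [rewrite in_setD1 eNe0|exists t].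
have key t : shared Q e t \/ Z (inc e t) ->
    shared (Q :\ e0) e t \/ Z' (inc e t).
  case=> [[e' e'Q [t' h]]|Zt].
    have [ee0|ne] := eqVneq e' e0.
      by right; exists t'; [apply: (e0e t); rewrite h ee0|rewrite h ee0].
    left; exists e'; last by exists t'.
    by move: e'Q; rewrite !in_setD1 ne.
  by case: nsh; apply: (e0e t); apply: Z1.
by exists e => // t1 t2 /key h1 /key h2; apply: eP.
Qed.

Lemma sparse_linear s (e e' : edge H) (t1 t2 t1' t2' : T) : 1 < s -> sparse s -> e != e' ->
  inc e t1 = inc e' t1' -> inc e t2 = inc e' t2' -> t1 = t2.
Proof.
move=> s1 sp ne h1 h2.
have sh (f f' : edge H) t t' : f != f' -> inc f t = inc f' t' ->
    shared [set f; f'] f t.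
  by move=> nf ff'; exists f'; [rewrite !inE eq_sym nf eqxx orbT|exists t'].
have [|f] := sp [set e; e']; first by rewrite cards2 ne.
case/set2P=> -> leaf; first by apply: leaf; [apply: sh h1|apply: sh h2].
rewrite eq_sym in ne; rewrite setUC in leaf.
suff t12 : t1' = t2' by apply: (@inc_inj T H e); rewrite h1 h2 t12.
by apply: leaf; [apply: sh (esym h1)|apply: sh (esym h2)].
Qed.

End Sparse.

Lemma pair_inj (A B : Type) (a : A) : injective (@pair A B a).
Proof. by move=> b1 b2 []. Qed.

(** * Partite amalgamation *)

Section Amalgam.

Variables (T C : finType) (s a : nat).

(* A partite hypergraph in which every colouring admits, for each choice of
   #|T| parts, an edge across these parts on which the colour depends only on the
   part, as far as the first [i] parts are concerned. *)
Definition partite_stage (i : nat) : Prop :=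
  exists (H : hypergraph T) (part : vert H -> 'I_a),
  [/\ sparse H s,
      forall e, injective (fun t => part (inc e t))
    & forall c : vert H -> C, exists k : 'I_a -> C,
        forall K : T -> 'I_a, injective K -> exists e, forall t,
          part (inc e t) = K t /\ (K t < i -> c (inc e t) = k (K t))].

(** The edges are disjoint, one for each injective choice of parts; the colour condition is
    vacuous. *)
Lemma partite_stage0 : 0 < #|C| -> partite_stage 0.
Proof.
case/card_gt0P=> c0 _.
pose ed : finType := {K : {ffun T -> 'I_a} | injectiveb K}.
pose ic (K : ed) (t : T) := (val K, t).
have ic_inj e : injective (ic e) by move=> t1 t2 [].
exists (Hypergraph ic_inj), (fun v : {ffun T -> 'I_a} * T => v.1 v.2); split=> /=.
- move=> Q /andP[/card_gt0P[/= e eQ] _]; exists e => // t1 t2 [e'].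
  by rewrite in_setD1 => /andP[ne _] [t' []] /val_inj ee'; rewrite ee' eqxx in ne.
- by move=> e t1 t2 /=; move/injectiveP: (valP e); apply.
move=> c; exists (fun=> c0) => K Kinj.
have KP : injectiveb (finfun K) by apply/injectiveP=> t1 t2; rewrite !ffunE; apply: Kinj.
by exists (exist _ (finfun K) KP) => t; rewrite /= ffunE.
Qed.

End Amalgam.

Section AmalgamStep.

Variables (T C : finType) (s a i : nat).
Variables (H : hypergraph T) (part : vert H -> 'I_a).
Hypothesis lt_ia : i < a.
Let oi := Ordinal lt_ia.
Let T' : finType := {v : vert H | part v == oi}.
Variable H' : hypergraph T'.

(* One copy of [H] for each edge [c] of [H'], with the part [i] of the copy
   identified with [c]. *)
Definition amalgam_vert (c : edge H') (v : vert H) :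
    (vert H' + edge H' * vert H)%type :=
  if insub v is Some v' then inl (inc c v') else inr (c, v).

Definition amalgam_part (x : vert H' + edge H' * vert H) : 'I_a :=
  if x is inr y then part y.2 else oi.

Lemma amalgam_partE c v : amalgam_part (amalgam_vert c v) = part v.
Proof. by rewrite /amalgam_vert; case: insubP => //= u /eqP->. Qed.

Lemma amalgam_vert_inj c : injective (amalgam_vert c).
Proof.
rewrite /amalgam_vert => v1 v2.
case: insubP => [u1 _ <-|_]; case: insubP => [u2 _ <-|_] //; last by case.
by case=> /inc_inj->.
Qed.

Lemma amalgam_vert_neq c1 c2 v1 v2 : c1 != c2 ->
  amalgam_vert c1 v1 = amalgam_vert c2 v2 ->
  exists2 u, v1 = val u & exists u', inc c1 u = inc c2 u'.
Proof.
rewrite /amalgam_vert => ne.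
case: insubP => [u1 _ <-|_]; case: insubP => [u2 _ _|_] //.
  by case=> h; exists u1 => //; exists u2.
by case=> ee; rewrite ee eqxx in ne.
Qed.

Definition amalgam_inc (e : edge H' * edge H) (t : T) :=
  amalgam_vert e.1 (inc e.2 t).

Lemma amalgam_inc_inj e : injective (amalgam_inc e).
Proof. by move=> t1 t2 /amalgam_vert_inj/inc_inj. Qed.

Definition amalgam : hypergraph T := Hypergraph amalgam_inc_inj.

(** Copies meet only inside part [i], which each edge meets at most once, so an edge of [Q] alone in
    its copy is a leaf. Otherwise at most half as many copies as edges occur, hence at most [s], and
    sparsity of [H'] gives a copy meeting the others in at most one vertex; [sparse_avoid] with this
    root finds the leaf. *)
Lemma sparse_amalgam : sparse H s.+1 ->
  (forall e, injective (fun t => part (inc e t))) -> sparse H' s ->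
  sparse amalgam s.+1.
Proof.
move=> spH part_inj spH' Q /andP[Q0 Qs].
pose Qc c := [set e | (c, e) \in Q].
pose D := [set e.1 | e in Q].
have QcQ c : #|Qc c| <= #|Q|.
  rewrite -(card_imset (mem (Qc c)) (@pair_inj _ _ c)) subset_leq_card //.
  by apply/subsetP=> _ /imsetP[e + ->]; rewrite inE.
have [/existsP[c /cards1P[e cE]]|/existsPn big] :=
    boolP [exists c, #|Qc c| == 1].
  have eQ : (c, e) \in Q by have := set11 e; rewrite -cE inE.
  have key t : shared Q (c, e) t -> part (inc e t) = oi.
    case=> [[c' e']]; rewrite in_setD1 => /andP[ne e'Q] [t'] /=.
    have nc : c != c'.
      apply: contra ne => /eqP cc; rewrite -cc in e'Q *.
      have : e' \in Qc c by rewrite inE.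
      by rewrite cE => /set1P->.
    by case/(amalgam_vert_neq nc) => u -> _; apply/eqP/(valP u).
  by exists (c, e) => // t1 t2 /key h1 /key h2; apply: (part_inj e); rewrite h1 h2.
have cQ : #|D| * 2 <= #|Q|.
  rewrite -[#|Q|]sum1_card (partition_big fst (mem D)) /=; last first.
    by move=> e eQ; apply: imset_f.
  rewrite -sum_nat_const; apply: leq_sum => c /imsetP[[c' e] eQ /= ->].
  rewrite sum1_card.
  have Qc_gt0 : 0 < #|Qc c'| by apply/card_gt0P; exists e; rewrite inE.
  apply: (@leq_trans #|Qc c'|).
    by move: (big c') Qc_gt0; case: #|Qc c'| => [|[|]].
  rewrite -(card_imset (mem (Qc c')) (@pair_inj _ _ c')) subset_leq_card //.
  by apply/subsetP=> _ /imsetP[f + ->]; rewrite inE unfold_in /= => ->; rewrite eqxx.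
have D0 : 0 < #|D|.
  by case/card_gt0P: Q0 => e eQ; apply/card_gt0P; exists e.1; apply: imset_f.
have [|c cD leafc] := spH' D; first by rewrite D0 /=; lia.
pose Z v := exists2 u, v = val u & shared D c u.
have [||e eQc leaf] := sparse_avoid (Z := Z) (Q := Qc c) spH.
- by move=> _ _ [u1 -> s1] [u2 -> s2]; rewrite (leafc _ _ s1 s2).
- rewrite (leq_trans (QcQ c) Qs) andbT.
  by case/imsetP: cD => -[c' e] eQ /= ->; apply/card_gt0P; exists e; rewrite inE.
rewrite inE in eQc; exists (c, e) => //.
have key t : shared Q (c, e) t -> shared (Qc c) e t \/ Z (inc e t).
  case=> [[c' e']]; rewrite in_setD1 => /andP[ne e'Q] [t'] /=.
  have [cc|nc] := eqVneq c c'.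
    rewrite -cc in ne e'Q * => /amalgam_vert_inj ee'; left; exists e'.
      by rewrite in_setD1 inE e'Q andbT; apply: contra ne => /eqP->.
    by exists t'.
  case/(amalgam_vert_neq nc) => u eu [u' uu']; right; exists u => //.
  exists c'; last by exists u'.
  by rewrite in_setD1 eq_sym nc; apply/imsetP; exists (c', e').
by move=> t1 t2 /key h1 /key h2; apply: leaf.
Qed.

End AmalgamStep.

(** Unavoidability of [H'] yields a copy of [H] whose part [i] is monochromatic; the colours of the
    earlier parts come from the previous stage inside that copy. *)
Lemma partite_stageS (T C : finType) s a i : 0 < #|C| ->
  (forall T' : finType, exists2 H : hypergraph T', sparse H s & unavoidable H C) ->
  i < a -> partite_stage T C s.+1 a i -> partite_stage T C s.+1 a i.+1.
Proof.
move=> C0 IHs lt_ia [H [part [spH part_inj col]]].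
have [H' spH' unH'] := IHs {v : vert H | part v == Ordinal lt_ia}.
exists (amalgam H'), (@amalgam_part _ _ _ _ part lt_ia H'); split.
- exact: sparse_amalgam.
- move=> [c e] t1 t2 /=; rewrite !amalgam_partE; exact: part_inj.
move=> c; have [c' c'P] := unH' (c \o inl).
have [k kP] := col (fun v => c (amalgam_vert c' v)).
(* If part [i] is empty, any colour serves as [d0]. *)
have [d0 dP] : exists d, forall u, c (inl (inc c' u)) = d.
  have [u _|no] := pickP (@predT {v : vert H | part v == Ordinal lt_ia}).
    by exists (c (inl (inc c' u))) => u'; apply: c'P.
  by have [c0 _] := card_gt0P C0; exists c0 => u; have := no u.
exists (fun j : 'I_a => if j == i :> nat then d0 else k j) => K Kinj.
have [e eP] := kP K Kinj; exists (c', e) => t.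
have [pe ce] := eP t; rewrite /= amalgam_partE; split=> // Kt.
have [Ki|nK] := eqVneq (K t : nat) i; last first.
  by rewrite -ce // ltn_neqAle nK -ltnS.
rewrite /amalgam_inc /= /amalgam_vert; case: insubP => [u _ _|]; first exact: dP.
by rewrite pe -val_eqE /= Ki eqxx.
Qed.

(** At [s = 0] sparsity is vacuous and all injections serve as edges. For [s.+1] the parts are
    treated one by one, and [pigeonhole] then picks [#|T|] parts of equal colour. [T] is generalized
    because the induction uses hyperedges as large as a whole part. *)
Theorem sparse_unavoidable (C : finType) (s : nat) (T : finType) : 0 < #|C| ->
  exists2 H : hypergraph T, sparse H s & unavoidable H C.
Proof.
move=> C0; elim: s T => [|s IHs] T; have a_ge := leqnn (#|C| * #|T|).
  pose a := #|C| * #|T|; pose ed : finType := {K : {ffun T -> 'I_a} | injectiveb K}.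
  have ic_inj (K : ed) : injective (fun t => val K t) by apply/injectiveP/(valP K).
  exists (Hypergraph ic_inj); first by move=> Q; case: #|Q|.
  move=> c; have [K Kinj Kc] := pigeonhole c C0 a_ge.
  have KP : injectiveb (finfun K).
    by apply/injectiveP=> t1 t2; rewrite !ffunE; apply: Kinj.
  by exists (exist _ (finfun K) KP) => t1 t2; rewrite /= !ffunE.
have stage i : i <= #|C| * #|T| -> partite_stage T C s.+1 (#|C| * #|T|) i.
  elim: i => [_|i IHi lt_i]; first exact: partite_stage0.
  by apply: partite_stageS => //; apply: IHi; apply: ltnW.
have [H [part [spH _ col]]] := stage _ a_ge.
exists H => // c; have [k kP] := col c.
have [K Kinj Kc] := pigeonhole k C0 a_ge.
have [e eP] := kP K Kinj; exists e => t1 t2.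
by have [_ ->//] := eP t1; have [_ ->//] := eP t2.
Qed.

(** * Exact hitting sets of sparse edge families *)

Section Forest.

Variables (T : finType) (H : hypergraph T).

Definition exact_on (Q : {set edge H}) (Y : {set vert H}) : Prop :=
  forall e, e \in Q -> exists t0, forall t, (inc e t \in Y) = (t == t0).

Lemma exact_on_count (Q : {set edge H}) Y e : exact_on Q Y -> e \in Q ->
  count (mem Y) (codom (inc e)) = 1.
Proof.
move=> QY /QY[t0 t0P]; rewrite /codom /image_mem count_map.
rewrite (eq_count (a2 := pred1 t0)) => [|t /=]; last by rewrite t0P.
by rewrite (count_uniq_mem _ (enum_uniq _)) mem_enum.
Qed.

Definition pendant (Q : {set edge H}) (e : edge H) (z : T) : Prop :=
  e \in Q /\ forall t, shared Q e t -> t = z.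

Lemma sparse_pendant s (Q : {set edge H}) : sparse H s -> 0 < #|T| -> 0 < #|Q| <= s ->
  exists e z, pendant Q e z.
Proof.
move=> sp /card_gt0P[t0 _] /sp[e eQ leaf]; exists e.
have [[z sz]|no] := classic (exists z, shared Q e z).
  by exists z; split=> // t st; apply: leaf.
by exists t0; split=> // t st; case: no; exists t.
Qed.

Definition tip (e : edge H) (z : T) (x : vert H) : bool :=
  [exists t, (t != z) && (x == inc e t)].

Lemma tipP e z x : reflect (exists2 t, t != z & x = inc e t) (tip e z x).
Proof.
apply: (iffP existsP) => [[t /andP[tz /eqP xt]]|[t tz ->]]; exists t => //.
by rewrite tz eqxx.
Qed.

Lemma tip_base e z : tip e z (inc e z) = false.
Proof. by apply/tipP=> -[t + /inc_inj zt]; rewrite zt eqxx. Qed.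

(* [Y] need only be changed on the free vertices of the leaf [e], those other
   than its attachment [z]. *)
Lemma extend_exact (Q : {set edge H}) e z p Y : pendant Q e z -> exact_on (Q :\ e) Y -> p != z ->
  exists Y', [/\ exact_on Q Y',
    forall t, (inc e t \in Y') = (t == if inc e z \in Y then z else p)
  & forall x, ~~ tip e z x -> (x \in Y') = (x \in Y)].
Proof.
move=> [eQ leaf] QY pz.
(* The leaf is hit at its attachment if that lies in [Y], and at [p] otherwise. *)
pose Y' := [set x | if tip e z x then (inc e z \notin Y) && (x == inc e p) else x \in Y].
have Y'nt x : ~~ tip e z x -> (x \in Y') = (x \in Y) by rewrite inE => /negPf->.
have Y'e t : (inc e t \in Y') = (t == if inc e z \in Y then z else p).
  have [->|tz] := eqVneq t z.
    rewrite Y'nt ?tip_base //; case: ifP; rewrite ?eqxx // => _.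
    by rewrite eq_sym (negPf pz).
  have tt : tip e z (inc e t) by apply/tipP; exists t.
  rewrite inE tt (inj_eq (@inc_inj T H e)).
  by case: ifP => //= _; rewrite (negPf tz).
exists Y'; split=> // e' e'Q; have [->|ne] := eqVneq e' e.
  by eexists => t; apply: Y'e.
have [|t0 t0P] := QY e'; first by rewrite in_setD1 ne.
exists t0 => t; rewrite -t0P Y'nt //; apply/tipP=> -[t' + h].
rewrite (leaf t') ?eqxx //; exists e'; first by rewrite in_setD1 ne.
by exists t.
Qed.

Variable s : nat.
Hypotheses (spH : sparse H s) (T3 : 2 < #|T|).

Lemma other_pos (t1 t2 : T) : exists p, (p != t1) && (p != t2).
Proof.
apply/existsP; apply: contraLR T3; rewrite negb_exists -leqNgt => /forallP h.
apply: (@leq_trans #|[set t1; t2]|); last by rewrite cards2; case: eqP.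
rewrite -cardsT; apply/subset_leq_card/subsetP=> p _; have := h p.
by rewrite !inE negb_and !negbK.
Qed.

(** Exact sets separate vertices. A pendant edge is removed; whether its free vertices belong to the
    set is settled by the attachment and the choice of [p], and [#|T| >= 3] leaves a third position
    to be hit. *)
Lemma exact_exists (Q : {set edge H}) u v (a : bool) : #|Q| <= s -> (u = v -> a = false) ->
  exists Y, [/\ exact_on Q Y, (u \in Y) = a & v \notin Y].
Proof.
have [n] := ubnP #|Q|; elim: n => // n IHn in Q u v a * => Qn Qs uv.
have [Q0|Q0] := posnP #|Q|.
  exists (if a then [set u] else set0); split.
  - by move=> e; rewrite (cards0_eq Q0) inE.
  - by case: a {uv}; rewrite !inE ?eqxx.
  - case: a uv => uv; rewrite !inE //.
    by apply/eqP=> vu; have := uv (esym vu).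
have [||e [z pend]] := sparse_pendant (Q := Q) spH; rewrite ?Q0 //.
  by apply: leq_trans T3.
have [eQ _] := pend; have cQ := cardsD1 e Q; rewrite eQ in cQ.
have {}IHn : forall u v (a : bool), (u = v -> a = false) ->
    exists Y, [/\ exact_on (Q :\ e) Y, (u \in Y) = a & v \notin Y].
  by move=> *; apply: IHn => //; lia.
have [/tipP[tu tuz ue]|nu] := boolP (tip e z u);
have [/tipP[tv tvz ve]|nv] := boolP (tip e z v).
- case: a uv => uv.
    have [//|Y [QY _ zY]] := IHn (inc e z) (inc e z) false.
    have [Y' [QY' Y'e _]] := extend_exact pend QY tuz.
    exists Y'; split=> //; first by rewrite ue Y'e (negPf zY) eqxx.
    rewrite ve Y'e (negPf zY); apply/eqP=> tvu.
    by have := uv; rewrite ue ve tvu => /(_ erefl).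
  have [|Y [QY zY _]] := IHn (inc e z) (inc e tu) true.
    by move/inc_inj=> zu; rewrite zu eqxx in tuz.
  have [Y' [QY' Y'e _]] := extend_exact pend QY tuz.
  by exists Y'; split=> //; rewrite ?ue ?ve Y'e zY //= (negPf tuz).
- have [//|Y [QY zY vY]] := IHn (inc e z) v false.
  have [p pz pE] : exists2 p, p != z & (tu == p) = a.
    case: a {uv}; first by exists tu; rewrite ?eqxx.
    have [p /andP[pu pz]] := other_pos tu z.
    by exists p => //; rewrite eq_sym (negPf pu).
  have [Y' [QY' Y'e Y'nt]] := extend_exact pend QY pz.
  by exists Y'; split=> //; [rewrite ue Y'e zY|rewrite Y'nt].
- have [|Y [QY uY _]] := IHn u (inc e tv) a.
    by move=> uv'; case/negP: nu; apply/tipP; exists tv.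
  have [p /andP[pv pz]] := other_pos tv z.
  have [Y' [QY' Y'e Y'nt]] := extend_exact pend QY pz.
  exists Y'; split=> //; first by rewrite Y'nt.
  by rewrite ve Y'e; case: ifP; rewrite // eq_sym.
- have [//|Y [QY uY vY]] := IHn u v a.
  have [p /andP[_ pz]] := other_pos z z.
  have [Y' [QY' _ Y'nt]] := extend_exact pend QY pz.
  by exists Y'; split; rewrite ?Y'nt.
Qed.

(** A pendant edge either is the word, up to order, or has no free vertex in it and can be
    removed. *)
Lemma exact_word (Q : {set edge H}) (w : seq (vert H)) : #|Q| <= s ->
  (forall Y, exact_on Q Y -> count (mem Y) w = 1) ->
  exists2 e, e \in Q & perm_eq w (codom (inc e)).
Proof.
have [n] := ubnP #|Q|; elim: n => // n IHn in Q * => Qn Qs wY.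
have [Q0|Q0] := posnP #|Q|.
  suff : count (mem (set0 : {set vert H})) w = 1.
    by rewrite (eq_count (a2 := pred0)) ?count_pred0 // => x; rewrite /= inE.
  by apply: wY => e; rewrite (cards0_eq Q0) inE.
have [||e [z pend]] := sparse_pendant (Q := Q) spH; rewrite ?Q0 //.
  by apply: leq_trans T3.
have [eQ _] := pend; have cQ := cardsD1 e Q; rewrite eQ in cQ.
have Q's : #|Q :\ e| <= s by lia.
pose w' := filter (predC (tip e z)) w.
have wY' Y p : exact_on (Q :\ e) Y -> p != z ->
    count (mem Y) w' + (if inc e z \in Y then 0 else count_mem (inc e p) w) = 1.
  move=> QY pz; have [Y' [QY' Y'e Y'nt]] := extend_exact pend QY pz.
  have split_w : count (mem Y') w =
      count (mem Y') w' + count (mem Y') (filter (tip e z) w).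
    by rewrite addnC -count_cat (seq.permP (permEl (perm_filterC (tip e z) w))).
  rewrite -(wY Y' QY') split_w; congr (_ + _).
    by apply: eq_in_count => x; rewrite mem_filter => /andP[/= nt _]; rewrite Y'nt.
  rewrite count_filter.
  have tp : tip e z (inc e p) by apply/tipP; exists p.
  case: ifP => zY.
    rewrite (eq_count (a2 := pred0)) ?count_pred0 // => x /=.
    apply/negP=> /andP[+ /tipP[t tz xe]].
    by rewrite xe Y'e zY (negPf tz).
  apply: eq_count => x /=; apply/eqP/andP => [->|[xY /tipP[t tz xe]]].
    by rewrite Y'e zY eqxx tp.
  by move: xY; rewrite xe Y'e zY => /eqP->.
(* A set missing the attachment shows that all free vertices have the same multiplicity, 0 or 1. *)
have [//|Y0 [QY0 _ zY0]] := exact_exists (u := inc e z) (v := inc e z) (a := false) Q's.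
have kP p : p != z -> count_mem (inc e p) w = 1 - count (mem Y0) w'.
  by move=> pz; have := wY' Y0 p QY0 pz; rewrite (negPf zY0); lia.
have [p0 /andP[p0z _]] := other_pos z z.
have [c0|c1] := posnP (count (mem Y0) w'); last first.
  have {}kP p : p != z -> count_mem (inc e p) w = 0 by move/kP; lia.
  have ww' : w' = w.
    apply/all_filterP/allP=> x xw; apply/tipP=> -[p pz xe].
    by have /count_memPn := kP p pz; rewrite -xe xw.
  have [||e' + we'] := IHn (Q :\ e) _ Q's; first by lia.
    move=> Y QY; have := wY' Y p0 QY p0z.
    by rewrite (kP _ p0z) ww'; case: ifP; rewrite addn0.
  by rewrite in_setD1 => /andP[_ e'Q]; exists e'.
(* Each free vertex now occurs once; separating sets show that the remaining letters are a single
   copy of the attachment. *)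
rewrite {}c0 in kP.
have wz x : x \in w' -> x = inc e z.
  move=> xw; apply/eqP/negPn/negP=> xz.
  have [/eqP|Y [QY xY zY]] := exact_exists (u := x) (v := inc e z) (a := true) Q's.
    by rewrite (negPf xz).
  have := wY' Y p0 QY p0z; rewrite (negPf zY) kP // => /eqP.
  rewrite -[X in _ == X]add0n eqn_add2r -leqn0 leqNgt -has_count => /hasP; case.
  by exists x.
have [|Y [QY zY _]] := exact_exists (u := inc e z) (v := inc e p0) (a := true) Q's.
  by move/inc_inj=> zp; rewrite zp eqxx in p0z.
have := wY' Y p0 QY p0z; rewrite zY addn0 => wY1.
exists e => //; rewrite /perm_eq; apply/allP=> x _; apply/eqP.
have uc : uniq (codom (inc e)) by apply/injectiveP/inc_inj.
rewrite (count_uniq_mem _ uc).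
have [tx|nx] := boolP (tip e z x).
  by have /tipP[p pz ->] := tx; rewrite kP // codom_f.
have -> : count_mem x w = count_mem x w'.
  rewrite count_filter; apply: eq_count => y /=.
  by case: eqP => // ->; rewrite nx.
have [->|xz] := eqVneq x (inc e z).
  rewrite codom_f -[RHS]wY1; apply: eq_in_count => y /wz->.
  by rewrite /= eqxx zY.
have -> : count_mem x w' = 0.
  by apply/count_memPn; apply: contra xz => /wz/eqP.
case: codomP => // -[t xt]; case/negP: nx; apply/tipP; exists t => //.
by apply: contra xz => /eqP<-; apply/eqP.
Qed.

End Forest.

(** * Identities and edge words *)

Fixpoint words (t : term) : seq (seq nat) :=
  match t with
  | Var n => [:: [:: n]]
  | Add s t => words s ++ words t
  | Mul s t => [seq w1 ++ w2 | w1 <- words s, w2 <- words t]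
  end.

Lemma words_exists t : exists w, w \in words t.
Proof.
elim: t => [n|s [w ws] t _|s [w1 w1s] t [w2 w2t]] /=.
- by exists [:: n]; rewrite inE.
- by exists w; rewrite mem_cat ws.
- by exists (w1 ++ w2); apply: allpairs_f.
Qed.

Lemma all_gtn_leq n n' (w : seq nat) : n <= n' -> all (gtn n) w -> all (gtn n') w.
Proof. by move=> nn'; apply: sub_all => i /= /leq_trans; apply. Qed.

Lemma words_bound t : exists n, forall w, w \in words t -> all (gtn n) w.
Proof.
elim: t => [k|s [n1 h1] t [n2 h2]|s [n1 h1] t [n2 h2]] /=.
- by exists k.+1 => w; rewrite inE => /eqP-> /=; rewrite ltnS leqnn.
- exists (maxn n1 n2) => w; rewrite mem_cat => /orP[/h1|/h2]; apply: all_gtn_leq;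
  by rewrite leq_max leqnn ?orbT.
- exists (maxn n1 n2) => _ /allpairsP[[w1 w2] [/= /h1 a1 /h2 a2 ->]].
  by rewrite all_cat (all_gtn_leq _ a1) ?(all_gtn_leq _ a2) // leq_max leqnn ?orbT.
Qed.

(** * The algebra of words modulo equal completions *)

Section EdgeWords.

Variables (T : finType) (H : hypergraph T) (s : nat).
Hypotheses (spH : sparse H s) (s_gt1 : 1 < s) (T3 : 2 < #|T|).

Definition is_edge (l : seq (vert H)) : Prop :=
  exists e, perm_eq l (codom (inc e)).

Lemma is_edge_perm l l' : perm_eq l l' -> is_edge l -> is_edge l'.
Proof.
by move=> ll' [e le]; exists e; apply: perm_trans le; rewrite perm_sym.
Qed.

Lemma is_edge_uniq l : is_edge l -> uniq l.
Proof.
by case=> e /perm_uniq->; apply/injectiveP/inc_inj.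
Qed.

Lemma is_edge_size l : is_edge l -> size l = #|T|.
Proof. by case=> e /perm_size->; rewrite size_codom. Qed.

Lemma edge_share a b c e1 e2 : 1 < size b ->
  perm_eq (a ++ b) (codom (inc e1)) -> perm_eq (c ++ b) (codom (inc e2)) ->
  e1 = e2 :> edge H.
Proof.
move=> b2 p1 p2; apply/eqP/negPn/negP=> ne.
have ub : uniq b.
  by have /is_edge_uniq : is_edge (a ++ b) by [exists e1]; rewrite cat_uniq => /and3P[].
have b1 x : x \in b -> x \in codom (inc e1).
  by move=> xb; rewrite -(perm_mem p1) mem_cat xb orbT.
have b2' x : x \in b -> x \in codom (inc e2).
  by move=> xb; rewrite -(perm_mem p2) mem_cat xb orbT.
case: b b2 ub b1 b2' {p1 p2} => [|x [|y b]] //= _ /and3P[+ _ _] b1 b2.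
rewrite inE => /norP[/eqP xy _]; case: xy.
have [/codomP[t1 h1] /codomP[t1' h1']] : x \in codom (inc e1) /\ x \in codom (inc e2).
  by rewrite b1 ?b2 ?inE ?eqxx.
have [/codomP[t2 h2] /codomP[t2' h2']] : y \in codom (inc e1) /\ y \in codom (inc e2).
  by rewrite b1 ?b2 ?inE ?eqxx ?orbT.
rewrite h1 h2; congr (inc _ _).
by apply: (sparse_linear s_gt1 spH ne); [rewrite -h1 h1'|rewrite -h2 h2'].
Qed.

(* Two distinct edges share at most one vertex and #|T| >= 3, so a context or a
   word with at least two letters determines its edge. *)
Lemma is_edge_cancel f g x y : is_edge (f ++ x) -> is_edge (f ++ y) ->
  is_edge (g ++ x) -> is_edge (g ++ y).
Proof.
move=> fx fy gx; have [[e1 p1] [e2 p2] [e3 p3]] := And3 fx fy gx.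
have [e12|ne] := eqVneq e1 e2.
  apply: is_edge_perm gx; rewrite perm_cat2l -(perm_cat2l f).
  by rewrite (perm_trans p1) // e12 perm_sym.
have f1 : size f <= 1.
  rewrite leqNgt; apply: contra ne => f2; apply/eqP.
  by apply: (@edge_share x f y) => //; rewrite perm_catC.
have x2 : 1 < size x.
  by have := is_edge_size fx; rewrite size_cat; lia.
have e13 := edge_share x2 p1 p3.
apply: is_edge_perm fy; rewrite perm_cat2r -(perm_cat2r x).
by rewrite (perm_trans p1) // e13 perm_sym.
Qed.

(* The algebra of words modulo "same completions to an edge"; words that do not
   divide an edge form the absorbing class, and the sum of two distinct classes
   is absorbing. *)
Definition residual (x f : seq (vert H)) : Prop := is_edge (f ++ x).

(** A class is represented by its set of completions, so the quotient becomes a subtype with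
    extensional equality. *)
Definition residual_class : Type :=
  {R : seq (vert H) -> Prop | exists x, R = residual x}.

Lemma residual_class_eq (R R' : residual_class) :
  (forall f, sval R f <-> sval R' f) -> R = R'.
Proof.
case: R R' => [R hR] [R' hR'] /= RR'.
have eqR : R = R' by apply: functional_extensionality => f; apply: propositional_extensionality.
by case: _ / eqR in hR' *; congr exist; apply: proof_irrelevance.
Qed.

(** With a common completion the two classes coincide, by [is_edge_cancel]; without one the
    intersection is empty, and a word with a repeated letter represents it. *)
Lemma residual_add (R R' : residual_class) :
  exists x, (fun f => sval R f /\ sval R' f) = residual x.
Proof.
have [[x ->] [y ->]] := (svalP R, svalP R').
have [[f [fx fy]]|no] := classic (exists f, residual x f /\ residual y f).
  exists x; apply: functional_extensionality => g.
  apply: propositional_extensionality; split=> [[]//|gx]; split=> //.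
  exact: is_edge_cancel fx fy gx.
(* The doubled word used below repeats a letter only if it is nonempty. *)
have [xy0|xy] := eqVneq (x ++ y) [::].
  exists x; apply: functional_extensionality => g.
  apply: propositional_extensionality; split=> [[]//|gx]; split=> //.
  by case: x y xy0 gx {no} => [|? ?] [|? ?].
exists ((x ++ y) ++ (x ++ y)); apply: functional_extensionality => g.
apply: propositional_extensionality; split=> [fxy|]; first by case: no; exists g.
move/is_edge_uniq; rewrite cat_uniq => /and3P[_ _].
case: (x ++ y) xy => // v l _; rewrite cat_uniq => /and3P[_ /hasP[]].
by exists v; rewrite /= inE eqxx.
Qed.

(** Quantifying over the representatives of [R] avoids choosing one; by [residual_mulE] the product
    is the class of the concatenation. *)
Definition residual_mul_fun (R R' : residual_class) (f : seq (vert H)) : Prop :=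
  exists2 x, sval R = residual x & sval R' (f ++ x).

Lemma residual_mulE (R R' : residual_class) x y :
  sval R = residual x -> sval R' = residual y ->
  forall f, residual_mul_fun R R' f <-> is_edge (f ++ x ++ y).
Proof.
move=> Rx R'y f; rewrite /residual_mul_fun R'y /residual catA.
split=> [[x' + fx'y]|fxy]; last by exists x.
rewrite Rx => /(congr1 (fun F => F (f ++ y))) xx'.
have : residual x (f ++ y).
  rewrite xx'; apply: is_edge_perm fx'y.
  by rewrite -!catA perm_cat2l perm_catC.
by apply: is_edge_perm; rewrite -!catA perm_cat2l perm_catC.
Qed.

Lemma residual_mul (R R' : residual_class) :
  exists x, residual_mul_fun R R' = residual x.
Proof.
have [[x Rx] [y R'y]] := (svalP R, svalP R').
exists (x ++ y); apply: functional_extensionality => g.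
by apply: propositional_extensionality; apply: residual_mulE.
Qed.

Definition residual_algebra : algebra :=
  @Algebra residual_class (fun R R' => exist _ _ (residual_add R R'))
    (fun R R' => exist _ _ (residual_mul R R')).

(** Addition intersects the sets of completions, and edges are words up to permutation, so the
    factors of a product can be expanded in turn. *)
Lemma eval_residual (v : nat -> residual_algebra) (x : nat -> seq (vert H)) t :
  (forall i, sval (v i) = residual (x i)) ->
  forall f, sval (eval v t : residual_class) f <->
    forall w, w \in words t -> is_edge (f ++ flatten (map x w)).
Proof.
move=> vx; elim: t => [n|t1 IH1 t2 IH2|t1 IH1 t2 IH2] f /=.
- rewrite vx; split=> [h w|/(_ [:: n])].
    by rewrite inE => /eqP->; rewrite /= cats0.
  by rewrite inE eqxx /= cats0; apply.
- rewrite IH1 IH2; split=> [[h1 h2] w|h].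
    by rewrite mem_cat => /orP[/h1|/h2].
  by split=> w wt; apply: h; rewrite mem_cat wt ?orbT.
have [a ha] := svalP (eval v t1 : residual_class).
have [b hb] := svalP (eval v t2 : residual_class).
rewrite (residual_mulE ha hb).
have step1 : is_edge (f ++ a ++ b) <-> residual a (f ++ b).
  by split; apply: is_edge_perm; rewrite -?catA perm_cat2l perm_catC.
rewrite step1 -ha IH1.
have step2 w : is_edge ((f ++ b) ++ flatten (map x w)) <->
    residual b (f ++ flatten (map x w)).
  by split; apply: is_edge_perm; rewrite -!catA perm_cat2l perm_catC.
split=> [h w|h w1 w1t].
  case/allpairsP=> -[w1 w2] /= [w1t w2t ->].
  move: (h w1 w1t); rewrite step2 -hb IH2 => /(_ w2 w2t).
  by rewrite -catA map_cat flatten_cat.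
rewrite step2 -hb IH2 => w2 w2t; rewrite -catA -flatten_cat -map_cat.
by apply: h; apply: allpairs_f.
Qed.

Lemma satisfies_residual p q :
  (forall x f, (forall w, w \in words p -> is_edge (f ++ flatten (map x w))) <->
               (forall w, w \in words q -> is_edge (f ++ flatten (map x w)))) ->
  satisfies residual_algebra (p, q).
Proof.
move=> pq v.
have vx i : {x | sval (v i : residual_class) = residual x}.
  exact: constructive_indefinite_description (svalP (v i : residual_class)).
apply: residual_class_eq => f.
by rewrite !(eval_residual (x := fun i => sval (vx i))) => // i; case: (vx i).
Qed.

End EdgeWords.

(** * Words in the power semiring and their levels *)

Section PowerWords.

Import GroupScope.

Variable gT : finGroupType.

Local Notation PG := (power_algebra gT).
Implicit Types (v : nat -> PG) (t p q : term).

Definition pset (X : PG) : {set gT} := val (X : nonempty_set gT).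

Lemma mem_eval_power v t (g : gT) :
  reflect (exists2 w, w \in words t & g \in \prod_(i <- w) pset (v i))
    (g \in pset (eval v t)).
Proof.
apply: (iffP idP); elim: t g => [n|t1 IH1 t2 IH2|t1 IH1 t2 IH2] g /=.
- by exists [:: n]; rewrite ?inE // big_seq1.
- rewrite /pset /= inE => /orP[/IH1|/IH2] [w wt gw]; exists w => //;
  by rewrite mem_cat wt ?orbT.
- case/mulsgP=> g1 g2 /IH1[w1 w1t gw1] /IH2[w2 w2t gw2] ->.
  exists (w1 ++ w2); first exact: allpairs_f.
  by rewrite big_cat mem_mulg.
- by case=> w; rewrite inE => /eqP->; rewrite big_seq1.
- case=> w; rewrite mem_cat /pset /= inE => /orP[wt|wt] gw.
    by rewrite [_ \in _]IH1 //; exists w.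
  by rewrite orbC [_ \in _]IH2 //; exists w.
- case=> _ /allpairsP[[w1 w2] [/= w1t w2t ->]].
  rewrite big_cat /= => /mulsgP[g1 g2 gw1 gw2 ->].
  by apply: mem_mulg; [apply: IH1; exists w1|apply: IH2; exists w2].
Qed.

Hypothesis G3 : 2 < #|gT|.

(* The value of a word containing [k] factors [G \ 1], the other factors being [1]. *)
Definition level (k : nat) : {set gT} :=
  match k with 0 => 1 | 1 => [set~ 1] | _ => setT end.

Lemma avoid2 (x y : gT) : exists g, (g != x) && (g != y).
Proof.
apply/existsP; apply: contraLR G3; rewrite negb_exists -leqNgt => /forallP h.
apply: (@leq_trans #|[set x; y]|); last by rewrite cards2; case: eqP.
rewrite -cardsT; apply/subset_leq_card/subsetP=> g _; have := h g.
by rewrite !inE negb_and !negbK.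
Qed.

Lemma level_neq0 k : level k != set0.
Proof.
apply/set0Pn; case: k => [|[|k]] /=; [by exists 1; rewrite inE| |by exists 1].
by have [g /andP[g1 _]] := avoid2 1 1; exists g; rewrite !inE.
Qed.

Lemma levelD a b : level a * level b = level (a + b).
Proof.
have mulTX (X : {set gT}) : X != set0 -> [set: gT] * X = [set: gT].
  case/set0Pn=> x xX; apply/setP=> g; rewrite inE; apply/mulsgP.
  by exists (g * x^-1) x; rewrite ?inE ?mulgKV.
have mulXT (X : {set gT}) : X != set0 -> X * [set: gT] = [set: gT].
  case/set0Pn=> x xX; apply/setP=> g; rewrite inE; apply/mulsgP.
  by exists x (x^-1 * g); rewrite ?inE ?mulKVg.
have A0 : [set~ 1] != set0 :> {set gT} by apply: (level_neq0 1).
have T0 : setT != set0 :> {set gT} by apply: (level_neq0 2).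
case: a b => [|[|a]] [|[|b]] //=; rewrite ?addn0 ?addnS ?mul1g ?mulg1 //=;
  rewrite ?mulTX ?mulXT //.
apply/setP=> g; rewrite inE; apply/mulsgP.
(* In [g = x * (x^-1 * g)] both factors differ from 1. *)
have [x /andP[x1 xg]] := avoid2 1 g.
exists x (x^-1 * g); rewrite ?mulKVg ?inE //.
by apply: contra xg => /eqP xg; rewrite -(mulKVg x g) xg mulg1.
Qed.

(** [1] and [[set~ 1]] are disjoint and neither contains [[set: gT]], so they are minimal among the
    levels. *)
Lemma level_sub k d : d <= 1 -> level k \subset level d -> k = d.
Proof.
have [g /andP[g1 _]] := avoid2 1 1.
case: d k => [|[|//]] [|[|k]] _ //= /subsetP;
  try by move/(_ g); rewrite !inE (negPf g1) => /(_ isT).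
- by move/(_ 1); rewrite !inE eqxx => /(_ isT).
- by move/(_ 1); rewrite !inE eqxx => /(_ isT).
Qed.

(** Under the levels given by [k] the value of [p] lies in [level d]; it contains the value of each
    word of [q], and minimality turns this into an equality of counts. *)
Lemma power_identity_count p q (k : nat -> nat) d :
  satisfies PG (p, q) -> d <= 1 ->
  (forall w, w \in words p -> \sum_(i <- w) k i = d) ->
  forall w, w \in words q -> \sum_(i <- w) k i = d.
Proof.
move=> pq d1 pd w wq; apply: level_sub => //.
pose v i : PG := exist _ (level (k i)) (level_neq0 (k i)).
have prodE u : \prod_(i <- u) pset (v i) = level (\sum_(i <- u) k i).
  by elim/big_rec2: _ => // i x y _ ->; rewrite levelD.
apply/subsetP=> g gw.
have : g \in pset (eval v q) by apply/mem_eval_power; exists w; rewrite ?prodE.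
by rewrite -[eval v q](pq v) => /mem_eval_power[u up]; rewrite prodE pd.
Qed.

End PowerWords.

Section LocalIdentity.

Variables (gT : finGroupType) (T : finType) (H : hypergraph T) (s n : nat).
Hypotheses (spH : sparse H s) (s_gt1 : 1 < s) (s_gt : 2 ^ n <= s).
Hypotheses (T3 : 2 < #|T|) (G3 : 2 < #|gT|).

(** An edge is determined by its vertices, hence here by [f] and the set of letters used, so at most
    [2 ^ n] edges matter. For [Y] exact on them the words of [p] count 1; [power_identity_count]
    passes this to [q], and [exact_word] concludes. *)
Lemma power_identity_edge p q (x : nat -> seq (vert H)) (f : seq (vert H)) :
  satisfies (power_algebra gT) (p, q) ->
  (forall w, w \in words p -> all (gtn n) w) ->
  (forall w, w \in words p -> is_edge (f ++ flatten (map x w))) ->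
  forall w, w \in words q -> is_edge (f ++ flatten (map x w)).
Proof.
move=> pq pn pe w wq.
pose span (I : {set 'I_n}) := [set v in f] :|: \bigcup_(i in I) [set v in x i].
(* The values of the words of [p] lie on at most [2 ^ n] edges. *)
pose Q : {set edge H} :=
  [set e | [exists I : {set 'I_n}, [set v in codom (inc e)] == span I]].
have Qs : #|Q| <= s.
  apply: leq_trans s_gt; pose F I := [pick e | [set v in codom (inc e)] == span I].
  rewrite -(card_imset _ (@Some_inj _)).
  apply: (@leq_trans #|F @: [set: {set 'I_n}]|); last first.
    by rewrite (leq_trans (leq_imset_card _ _)) // -powersetT card_powerset cardsT card_ord.
  apply/subset_leq_card/subsetP=> _ /imsetP[e + ->].
  rewrite inE => /existsP[I /eqP eI]; apply/imsetP; exists I => //.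
  rewrite /F; case: pickP => [e' /eqP e'I|/(_ e)]; last by rewrite eI eqxx.
  congr Some; apply: (@edge_share _ _ _ spH s_gt1 [::] (codom (inc e)) [::]) => //=.
    by rewrite size_codom ltnW.
  apply: uniq_perm; try by apply/injectiveP/inc_inj.
  by move=> v; have /setP/(_ v) : [set v in codom (inc e)] = [set v in codom (inc e')]
    by [rewrite eI e'I]; rewrite !inE.
have edgeQ u : u \in words p ->
    exists2 e, e \in Q & perm_eq (f ++ flatten (map x u)) (codom (inc e)).
  move=> up; have [e ue] := pe u up; exists e => //.
  rewrite inE; apply/existsP; exists [set i : 'I_n | val i \in u].
  apply/eqP/setP=> v; rewrite !inE -(perm_mem ue) mem_cat; congr (_ || _).
  apply/flattenP/bigcupP => [[_ /mapP[i iu ->] vx]|[i]].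
    have := allP (pn u up) i iu => /= ltin.
    by exists (Ordinal ltin); rewrite inE.
  by rewrite !inE => iu vx; exists (x i) => //; apply: map_f.
suff [e _ we] : exists2 e, e \in Q & perm_eq (f ++ flatten (map x w)) (codom (inc e)).
  by exists e.
apply: (exact_word spH T3 Qs) => Y QY.
pose k i := count (mem Y) (x i).
have countE u : count (mem Y) (f ++ flatten (map x u)) =
    count (mem Y) f + \sum_(i <- u) k i.
  rewrite count_cat; congr (_ + _); elim: u => [|i u IHu] /=; first by rewrite big_nil.
  by rewrite big_cons count_cat IHu.
have p1 u : u \in words p -> count (mem Y) f + \sum_(i <- u) k i = 1.
  by case/edgeQ=> e eQ /seq.permP ue; rewrite -countE ue (exact_on_count QY).
have [u up] := words_exists p; have := p1 u up => fu.
(* The letters of [f] in [Y] already contribute to the total count 1. *)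
rewrite countE (power_identity_count (k := k) G3 pq (d := 1 - count (mem Y) f)) //.
- by lia.
- exact: leq_subr.
- by move=> u' /p1; lia.
Qed.

End LocalIdentity.

(** Without constants there is no empty product or sum, so [word_term] and [sum_term] take a
    starting term. *)
Definition word_term (t : term) (w : seq nat) : term :=
  foldl (fun t i => Mul t (Var i)) t w.

Lemma words_word_term t w : words (word_term t w) = [seq u ++ w | u <- words t].
Proof.
elim: w t => [|i w IHw] t /=.
  by rewrite -[LHS]map_id; apply: eq_map => u; rewrite cats0.
rewrite {}IHw /=; elim: (words t) => //= u ws IH.
by rewrite -catA /= IH.
Qed.

Definition sum_term (t : term) (ts : seq term) : term := foldr Add t ts.

Lemma words_sum_term t ts w :
  (w \in words (sum_term t ts)) = has (fun u => w \in words u) (rcons ts t).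
Proof.
by elim: ts => [|u ts IH] /=; rewrite ?orbF // mem_cat IH.
Qed.

Lemma generated_variety_refl A : generated_variety A A.
Proof. by []. Qed.

Lemma generated_variety_satisfies A B e :
  generated_variety A B -> satisfies A e -> satisfies B e.
Proof.
move=> AB Ae; apply: (AB (fun C => satisfies C e)) => //.
exists (fun e' => e' = e) => C; split=> [Ce _ -> //|]; exact.
Qed.

Lemma basis_words_bound (E : seq identity) : exists n, forall e, List.In e E ->
  forall w, w \in words e.1 ++ words e.2 -> all (gtn n) w.
Proof.
elim: E => [|e E [n nP]]; first by exists 0.
have [n1 n1P] := words_bound (Add e.1 e.2).
exists (maxn n n1) => e' [<- w /n1P|/nP h w /h]; apply: all_gtn_leq;
by rewrite leq_max leqnn ?orbT.
Qed.

(** * The identity attached to a hypergraph *)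

Section EdgeIdentity.

Variables (T : finType) (H : hypergraph T).

(** Variable 0 is reserved for [u] in the identity [u + u t = u t]. *)
Definition vertex_var (x : vert H) : nat := (enum_rank x).+1.

Definition edge_term (e : edge H) : term :=
  word_term (Var 0) [seq vertex_var x | x <- codom (inc e)].

Definition edge_sum (e0 : edge H) : term :=
  sum_term (edge_term e0) [seq edge_term e | e <- enum (edge H)].

Lemma words_edge_sum e0 w : reflect
  (exists e, w = 0 :: [seq vertex_var x | x <- codom (inc e)])
  (w \in words (edge_sum e0)).
Proof.
rewrite words_sum_term has_rcons has_map.
apply: (iffP orP) => [[|/hasP[e _]]|[e ->]] /=.
- by rewrite words_word_term inE => /eqP->; exists e0.
- by rewrite words_word_term inE => /eqP->; exists e.
by right; apply/hasP; exists e; rewrite ?mem_enum //= words_word_term inE.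
Qed.

Definition edge_identity (e0 : edge H) : identity :=
  (Add (Var 0) (edge_sum e0), edge_sum e0).

(** With variable 0 at the empty word and each vertex at itself, the empty word completes the right
    side; on the left this would make the empty word an edge. *)
Lemma residual_not_edge_identity s (spH : sparse H s) (s_gt1 : 1 < s)
    (T3 : 2 < #|T|) e0 :
  ~ satisfies (residual_algebra spH s_gt1 T3) (edge_identity e0).
Proof.
pose x j : seq (vert H) := [seq y <- enum (vert H) | vertex_var y == j].
have x0 : x 0 = [::] by rewrite /x /vertex_var; elim: (enum _).
have xV y : x (vertex_var y) = [:: y].
  rewrite /x (eq_filter (a2 := pred1 y)) ?filter_pred1_uniq ?enum_uniq ?mem_enum //.
  by move=> z; rewrite /vertex_var eqSS val_eqE (inj_eq enum_rank_inj).
pose v j : residual_algebra spH s_gt1 T3 := exist _ (residual (x j)) (ex_intro _ (x j) erefl).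
move=> /(_ v)/(congr1 (fun R : residual_class H => sval R [::])) eqv.
have : sval (eval v (edge_sum e0) : residual_class H) [::].
  apply/(eval_residual (x := x)) => // _ /words_edge_sum[e ->] /=.
  exists e; rewrite x0 /= -map_comp (eq_map (g := fun y => [:: y])) ?flatten_seq1 //.
rewrite -[sval _ _]eqv => /(eval_residual (x := x) _ _ _) => /(_ (fun=> erefl)).
move=> /(_ [:: 0]); rewrite inE eqxx /= x0 => /(_ isT) /is_edge_size T0.
by have := T3; rewrite -T0.
Qed.

Import GroupScope.

(* A monochromatic edge of the colouring [c] multiplies to [k ^+ #|gT| = 1]. *)
Lemma power_edge_identity (gT : finGroupType) e0 : unavoidable H gT ->
  #|T| = #|gT| -> satisfies (power_algebra gT) (edge_identity e0).
Proof.
move=> unH cT v; apply: val_inj => /=; apply/setUidPr/subsetP=> g gv0.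
(* One element chosen from the value of each variable, with [g] for variable 0; on the vertices this
   is a colouring by [gT]. *)
pose h i := if i is 0 then g else repr (pset (v i)).
have hv i : h i \in pset (v i).
  case: i => // i; have /set0Pn[k kv] : pset (v i.+1) != set0.
    by apply: (valP (v i.+1 : nonempty_set gT)).
  exact: mem_repr kv.
have mem_h l : \prod_(i <- l) h i \in \prod_(i <- l) pset (v i).
  by elim: l => [|i l IHl]; rewrite ?big_nil ?inE // !big_cons mem_mulg.
have [e ce] := unH (fun y => h (vertex_var y)).
apply/mem_eval_power; exists (0 :: [seq vertex_var y | y <- codom (inc e)]).
  by apply/words_edge_sum; exists e.
have -> : g = \prod_(i <- 0 :: [seq vertex_var y | y <- codom (inc e)]) h i.
  rewrite big_cons big_map /=; have [t _|noT] := pickP (@predT T); last first.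
    by rewrite /codom /image_mem (eq_enum (B := pred0)) ?enum0 ?big_nil ?mulg1.
  rewrite (eq_big_seq (fun=> h (vertex_var (inc e t)))) => [|_ /codomP[t' ->]]; last exact: ce.
  have prod_const (l : seq (vert H)) k : \prod_(y <- l) k = k ^+ size l :> gT.
    by elim: l => [|y l IHl]; rewrite ?big_nil // big_cons IHl -expgS.
  rewrite prod_const size_codom cT -cardsT [_ ^+ _](_ : _ = 1) ?mulg1 //.
  by apply: expg_cardG; rewrite inE.
exact: mem_h.
Qed.

End EdgeIdentity.

Theorem power_nonfinitely_based (gT : finGroupType) : 2 < #|gT| ->
  ~ finitely_based (power_algebra gT).
Proof.
move=> G3 [E EP]; have [n nP] := basis_words_bound E.
have PE e : List.In e E -> satisfies (power_algebra gT) e.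
  by move: e; apply/EP; apply: generated_variety_refl.
(* The bound 2 makes two edges share at most one vertex; [2 ^ n] covers the edges spelled with [n]
   letters. *)
have [|H spH unH] := sparse_unavoidable (C := gT) (maxn 2 (2 ^ n)) 'I_#|gT|.
  exact: ltnW (ltnW G3).
have s1 : 1 < maxn 2 (2 ^ n) by rewrite leq_max.
have T3 : 2 < #|'I_#|gT| | by rewrite card_ord.
have [e0 _] := unH (fun=> 1%g).
apply: (residual_not_edge_identity (spH := spH) (s_gt1 := s1) (T3 := T3) (e0 := e0)).
apply: (@generated_variety_satisfies (power_algebra gT)); last first.
  by apply: power_edge_identity; rewrite ?card_ord.
apply/EP => -[p q] eE; have pq := PE _ eE.
have sn : 2 ^ n <= maxn 2 (2 ^ n) by rewrite leq_max leqnn orbT.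
apply: satisfies_residual => x f.
have qp : satisfies (power_algebra gT) (q, p) by move=> v; rewrite (pq v).
split; [apply: (power_identity_edge spH s1 sn T3 G3 pq)|
        apply: (power_identity_edge spH s1 sn T3 G3 qp)] => w wpq;
by apply: (nP _ eE); rewrite mem_cat wpq ?orbT.
Qed.

(** * Groups of order at most two *)

Lemma finitely_based_complete (A : algebra) (E : seq identity) :
  (forall e, List.In e E -> satisfies A e) ->
  (forall B : algebra, (forall e, List.In e E -> satisfies B e) ->
    forall p q, satisfies A (p, q) -> satisfies B (p, q)) ->
  finitely_based A.
Proof.
move=> AE complete; exists E => B; split=> [AB e /AE|BE V [F VF] /VF AF].
  exact: generated_variety_satisfies.
by apply/VF => -[p q] /AF; apply: complete.
Qed.

Lemma finitely_based_trivial (A : algebra) :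
  (forall x y : A, x = y) -> finitely_based A.
Proof.
move=> A1; apply: (@finitely_based_complete A [:: (Var 0, Var 1)]) => [e _ v|B BE p q _ v].
  exact: A1.
exact: (BE _ (or_introl erefl) (fun i => if i is 0 then eval v p else eval v q)).
Qed.

(** * Word sets closed under triples and cancellation of squares *)

Section WordClosure.

Variable D : seq nat -> Prop.
Hypothesis D_perm : forall w w', perm_eq w w' -> D w -> D w'.
Hypothesis D_square : forall w l, w != [::] -> D (w ++ l ++ l) -> D w.
Hypothesis D_triple : forall w1 w2 w3, D w1 -> D w2 -> D w3 -> D (w1 ++ w2 ++ w3).

Lemma closure_odd ws : (forall w, w \in ws -> D w) -> odd (size ws) -> D (flatten ws).
Proof.
have [n] := ubnP (size ws); elim: n => // n IHn in ws *.
case: ws => [|w1 [|w2 [|w3 ws]]] //= szw Dws; first by rewrite cats0 => _; apply/Dws/mem_head.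
rewrite !negbK => oddws.
have: D (flatten (w3 :: ws)).
  apply: IHn => [|w wws|//]; first by rewrite /=; lia.
  by apply: Dws; rewrite !inE in wws *; rewrite wws !orbT.
by apply: D_triple; apply: Dws; rewrite !inE eqxx ?orbT.
Qed.

Lemma closure_even r w : w != [::] -> (forall i, ~~ odd (count_mem i r)) ->
  D (w ++ r) -> D w.
Proof.
have [n] := ubnP (size r); elim: n => // n IHn in r *.
case: r => [|i r] szr w0 er; first by rewrite cats0.
have ir : i \in r.
  by have := er i; rewrite /= eqxx -has_pred1 has_count; case: (count_mem i r).
have pr := perm_to_rem ir => Dwr.
apply: (IHn (rem i r)) => //.
- by have := perm_size pr => /= sr; rewrite /= sr in szr; lia.
- by move=> j; have := er j; rewrite /= (seq.permP pr) /= addnA oddD addnn odd_double.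
apply: (@D_square _ [:: i]); first by case: (w) w0.
apply: D_perm Dwr; rewrite -catA perm_cat2l perm_sym perm_catC /=.
by rewrite perm_cons perm_sym.
Qed.

(** [D_triple] appends [u] twice, and [D_square] cancels the square of the rest of [u], leaving [i]
    twice. *)
Lemma closure_cover w0 l : D w0 -> (forall i, i \in l -> exists2 u, D u & i \in u) ->
  D (w0 ++ l ++ l).
Proof.
move=> Dw0; elim: l => [|i l IHl] lD; first by rewrite !cats0.
have [u Du iu] := lD i (mem_head _ _).
have {}IHl : D (w0 ++ l ++ l) by apply: IHl => j jl; apply: lD; rewrite inE jl orbT.
have pu := perm_to_rem iu.
apply: (@D_square _ (rem i u)); first by case: (w0).
apply: D_perm (D_triple IHl Du Du).
apply/seq.permP => a; rewrite !count_cat /= ?count_cat !(seq.permP pu) /= ?count_cat /=; lia.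
Qed.

(** In [w ++ (flatten ws ++ w)], obtained from [closure_cover] by permutation, the bracketed part
    has even counts and cancels. *)
Lemma closure_word ws w : w != [::] -> (forall u, u \in ws -> D u) -> odd (size ws) ->
  (forall i, odd (count_mem i (flatten ws)) = odd (count_mem i w)) ->
  (forall i, i \in w -> exists2 u, D u & i \in u) -> D w.
Proof.
move=> w0 wsD odd_ws par wD; apply: (@closure_even (flatten ws ++ w)) => //.
  by move=> i; rewrite count_cat oddD par addbb.
have := closure_cover (closure_odd wsD odd_ws) wD.
by apply: D_perm; rewrite perm_catCA.
Qed.

End WordClosure.

(* [(x + y) z = x z + y z] is omitted, as multiplication is commutative. *)
Definition two_basis : seq identity :=
  let x := Var 0 in let y := Var 1 in let z := Var 2 in
  [:: (Add x (Add y z), Add (Add x y) z); (Add x y, Add y x); (Add x x, x);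
      (Mul x (Mul y z), Mul (Mul x y) z); (Mul x y, Mul y x);
      (Mul x (Add y z), Add (Mul x y) (Mul x z));
      (Add x (Mul (Mul x y) y), Mul (Mul x y) y);
      (Add (Mul (Mul x y) z) (Add (Add x y) z), Add (Add x y) z)].

(** * Consequences of the basis for order two *)

Section TwoModel.

Variable B : algebra.
Local Notation add := (@add_op B).
Local Notation mul := (@mul_op B).
Hypotheses (addA : associative add) (addC : commutative add) (addI : idempotent_op add).
Hypotheses (mulA : associative mul) (mulC : commutative mul).
Hypothesis mulDr : right_distributive mul add.
Hypothesis square_le : forall x y, add x (mul (mul x y) y) = mul (mul x y) y.
Hypothesis triple_le : forall x y z,
  add (mul (mul x y) z) (add (add x y) z) = add (add x y) z.

Definition below_elt (x y : B) : Prop := add x y = y.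
Local Notation le := below_elt.

Lemma below_elt_trans x y z : le x y -> le y z -> le x z.
Proof. by rewrite /below_elt => xy <-; rewrite addA xy. Qed.

Lemma below_elt_add x y z : le (add x y) z <-> le x z /\ le y z.
Proof.
split=> [xyz|[xz yz]]; last by rewrite /below_elt -addA yz.
by split; apply: below_elt_trans xyz; rewrite /below_elt;
  [rewrite addA addI|rewrite addC -addA addI].
Qed.

(** Adjoining [None] as a unit gives a commutative monoid, to which big operators apply. *)
Local Notation omul := (oAC mulA mulC).

(** The empty product is below nothing, whence the condition that [w] be nonempty in
    [below_square]. *)
Definition below_opt (o : option B) (z : B) : Prop := if o is Some x then le x z else False.

Arguments below_opt : simpl never.

Variable v : nat -> B.

Definition word_eval (w : seq nat) : option B := \big[omul/None]_(i <- w) Some (v i).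

Let omulA : associative omul := oopA_subdef mulA mulC.

Let omulAC : right_commutative omul.
Proof. by move=> x y z; rewrite -!omulA [omul y z]oopC_subdef. Qed.

Lemma word_eval_cat w1 w2 : word_eval (w1 ++ w2) = omul (word_eval w1) (word_eval w2).
Proof. exact: big_cat. Qed.

Lemma word_eval_cons i w : exists x, word_eval (i :: w) = Some x.
Proof.
rewrite /word_eval big_cons; case: (\big[_/_]_(_ <- _) _) => [y|]; eexists; last first.
  by rewrite Monoid.mulm1.
by rewrite oACE.
Qed.

(** The context [c] carries the induction through products: each factor in turn joins the context of
    the other. *)
Lemma below_opt_eval t c z : below_opt (omul c (Some (eval v t))) z <->
  forall w, w \in words t -> below_opt (omul c (word_eval w)) z.
Proof.
elim: t c => [n|t1 IH1 t2 IH2|t1 IH1 t2 IH2] c /=.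
- split=> [h w|/(_ [:: n])]; last by rewrite inE eqxx /word_eval big_seq1; apply.
  by rewrite inE => /eqP->; rewrite /word_eval big_seq1.
- have -> : below_opt (omul c (Some (add (eval v t1) (eval v t2)))) z <->
      below_opt (omul c (Some (eval v t1))) z /\ below_opt (omul c (Some (eval v t2))) z.
    case: c => [c|]; last by rewrite !Monoid.mul1m /=; apply: below_elt_add.
    by rewrite !oACE /= mulDr; apply: below_elt_add.
  rewrite IH1 IH2; split=> [[h1 h2] w|h].
    by rewrite mem_cat => /orP[/h1|/h2].
  by split=> w wt; apply: h; rewrite mem_cat wt ?orbT.
have -> : omul c (Some (mul (eval v t1) (eval v t2))) =
    omul (omul c (Some (eval v t2))) (Some (eval v t1)).
  by rewrite -omulA (mulC (eval v t1)).
rewrite IH1; split=> [h _ /allpairsP[[w1 w2] [/= w1t w2t ->]]|h w1 w1t].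
  by move: (h w1 w1t); rewrite omulAC IH2 => /(_ w2 w2t); rewrite -omulA word_eval_cat.
rewrite omulAC IH2 => w2 w2t; rewrite -omulA -word_eval_cat.
by apply: h; apply: allpairs_f.
Qed.

Definition below (T : B) (w : seq nat) := below_opt (word_eval w) T.

Lemma below_perm T w w' : perm_eq w w' -> below T w -> below T w'.
Proof. by move=> ww'; rewrite /below /word_eval (perm_big _ ww'). Qed.

Lemma below_square T w l : w != [::] -> below T (w ++ l ++ l) -> below T w.
Proof.
case: w => // i w _; case: l => [|j l]; first by rewrite !cats0.
rewrite /below !word_eval_cat.
have [[x ->] [y ->]] := (word_eval_cons i w, word_eval_cons j l).
by rewrite !oACE /= mulA; apply: below_elt_trans (square_le x y).
Qed.

Lemma below_triple T w1 w2 w3 :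
  below T w1 -> below T w2 -> below T w3 -> below T (w1 ++ w2 ++ w3).
Proof.
rewrite /below !word_eval_cat.
case: (word_eval w1) (word_eval w2) (word_eval w3) => [x|] [y|] [z|] //= xT yT zT.
rewrite omulA; apply: below_elt_trans (triple_le x y z) _.
by rewrite !below_elt_add.
Qed.

Definition covered (p : term) (w : seq nat) : Prop :=
  (exists ws, [/\ {subset ws <= words p}, odd (size ws) &
     forall i, odd (count_mem i (flatten ws)) = odd (count_mem i w)]) /\
  (forall i, i \in w -> exists2 u, u \in words p & i \in u).

Lemma words_neq0 t w : w \in words t -> w != [::].
Proof.
elim: t w => [n|t1 IH1 t2 IH2|t1 IH1 t2 IH2] w /=.
- by rewrite inE => /eqP->.
- by rewrite mem_cat => /orP[/IH1|/IH2].
- by case/allpairsP=> -[w1 w2] [/= /IH1 + _ ->]; case: w1.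
Qed.

Lemma covered_le p q : (forall w, w \in words q -> covered p w) ->
  add (eval v q) (eval v p) = eval v p.
Proof.
have pD u : u \in words p -> below (eval v p) u.
  have pp : below_opt (omul None (Some (eval v p))) (eval v p) by apply: addI.
  by move=> up; have := proj1 (below_opt_eval p None (eval v p)) pp u up; rewrite oopx1_subdef.
move=> pq; apply: (proj2 (below_opt_eval q None (eval v p))) => w wq; rewrite oopx1_subdef.
have [[ws [wsp odd_ws par]] cov] := pq w wq.
apply: (@closure_word (below (eval v p)) _ _ _ ws) => //.
- exact: below_perm.
- exact: below_square.
- exact: below_triple.
- exact: words_neq0 wq.
- by move=> u /wsp/pD.
- by move=> i /cov[u /pD Du iu]; exists u.
Qed.

End TwoModel.

(** * Odd combinations over the field of two elements *)

Section OddSpan.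

Import GRing.Theory.
Local Open Scope ring_scope.

Lemma F2_natr_eq (m k : nat) : (m%:R = k%:R :> 'F_2) <-> odd m = odd k.
Proof.
have natr_odd i : i%:R = (odd i)%:R :> 'F_2.
  rewrite -{1}(odd_double_half i) -muln2 natrD natrM.
  have -> : 2%:R = 0 :> 'F_2 by apply: val_inj.
  by rewrite mulr0 addr0.
split=> [|h]; last by rewrite natr_odd h -natr_odd.
rewrite natr_odd [k%:R]natr_odd; by case: (odd m) (odd k) => [] [].
Qed.

Lemma F2_neq0 (x : 'F_2) : x != 0 -> x = 1.
Proof. by case: x => [[|[|k]] lt_k] //= _; apply: val_inj. Qed.

(* If [w] were not an odd combination of [W] over F_2, a linear functional
   separating it from the affine span of [W] would refute the hypothesis;
   the marker letter [n] homogenizes affine combinations into linear ones. *)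
Lemma odd_span (W : seq (seq nat)) (w : seq nat) (n : nat) :
  (forall u, u \in w :: W -> all (gtn n) u) ->
  (forall h : nat -> nat, exists2 u, u \in W &
     odd (\sum_(i <- w) h i)%N = odd (\sum_(i <- u) h i)%N) ->
  exists ws, [/\ {subset ws <= W}, odd (size ws) &
    forall i, odd (count_mem i (flatten ws)) = odd (count_mem i w)].
Proof.
move=> lt_n sep.
pose M : 'M['F_2]_(size W, n.+1) :=
  \matrix_(i < size W, j < n.+1) (count_mem (j : nat) (n :: nth [::] W i))%:R.
pose a : 'rV['F_2]_n.+1 := \row_(j < n.+1) (count_mem (j : nat) (n :: w))%:R.
have [/submxP[D aD]|] := boolP (a <= M)%MS.
  pose ws := [seq nth [::] W (i : 'I__) | i <- enum 'I_(size W) & D 0 i != 0].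
  have wsW : {subset ws <= W}.
    by move=> _ /mapP[i _ ->]; apply: mem_nth.
  have key (j : 'I_n.+1) :
      odd (count_mem (j : nat) (n :: w)) = odd (\sum_(u <- ws) count_mem (j : nat) (n :: u))%N.
    apply/F2_natr_eq; have /rowP/(_ j) := aD; rewrite !mxE => ->.
    rewrite natr_sum big_map big_filter big_enum_cond [RHS]big_mkcondr /=.
    apply: eq_bigr => i _; rewrite mxE.
    by case: eqVneq => [->|/F2_neq0->]; rewrite ?mul0r ?mul1r.
  have not_n u : u \in w :: W -> count_mem n u = 0%N.
    move=> uW; apply/count_memPn/negP=> nu.
    by have := allP (lt_n u uW) n nu; rewrite /= ltnn.
  exists ws; split=> // [|i].
    (* The marker occurs once in each word, so its column gives the parity of the number of words
       chosen. *)
    have := key ord_max; rewrite (eq_big_seq (fun=> 1%N)) ?sum1_size => [<-|u /wsW uW].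
      by rewrite /= eqxx not_n ?mem_head.
    by rewrite /= eqxx not_n // inE uW orbT.
  have flat : count_mem i (flatten ws) = (\sum_(u <- ws) count_mem i u)%N.
    by rewrite count_flatten sumnE big_map.
  have [lt_in|le_ni] := ltnP i n; last first.
    have out u : u \in w :: W -> count_mem i u = 0%N.
      move=> uW; apply/count_memPn/negP=> iu.
      by have := allP (lt_n u uW) i iu; rewrite /= ltnNge le_ni.
    rewrite flat out ?mem_head // big1_seq // => u /andP[_ /wsW uW].
    by rewrite out // inE uW orbT.
  have ni : (n == i) = false by rewrite gtn_eqF.
  have := key (Ordinal (ltnW lt_in : i < n.+1)%N); rewrite /= ni flat => ->.
  by congr odd; apply: eq_bigr => u _; rewrite /= ni.
(* A column of [cokermx M] is a functional that vanishes on the rows of [M] but not on [a]; [h]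
   lists its values on the letters. *)
rewrite submxE => /matrix0Pn[i0 [c]]; rewrite (ord1 i0) => {i0} ac.
set K := cokermx M in ac *.
pose h i : nat := K (inord i) c.
have hK l : all (gtn n.+1) l ->
    \sum_(j < n.+1) (count_mem (j : nat) l)%:R * K j c = (\sum_(i <- l) h i)%N%:R.
  elim: l => [_|i l IHl /= /andP[lt_i lt_l]].
    by rewrite big_nil big1 // => j _; rewrite mul0r.
  rewrite big_cons natrD -IHl // natr_Zp.
  rewrite (eq_bigr (fun j : 'I_n.+1 => (i == j)%:R * K j c + (count_mem (j : nat) l)%:R * K j c));
    last by move=> j _; rewrite /= natrD mulrDl.
  rewrite big_split /=; congr (_ + _).
  rewrite (bigD1 (inord i)) //= inordK // eqxx mul1r big1 ?addr0 // => j ji.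
  have -> : (i == j) = false by apply: contraNF ji => /eqP->; rewrite inord_val.
  by rewrite mul0r.
have lt_n1 u : u \in w :: W -> all (gtn n.+1) (n :: u).
  move=> /lt_n; rewrite /= ltnS leqnn; apply: sub_all => i /=; exact: ltnW.
have [u uW wu] := sep h; case/negP: ac; apply/eqP.
have -> : (a *m K) 0 c = (\sum_(i <- n :: w) h i)%N%:R.
  rewrite mxE -hK ?lt_n1 ?mem_head //; apply: eq_bigr => j _.
  by rewrite !mxE.
have -> : (\sum_(i <- n :: w) h i)%N%:R = (\sum_(i <- n :: u) h i)%N%:R :> 'F_2.
  by apply/F2_natr_eq; rewrite !big_cons !oddD wu.
have lt_u : (index u W < size W)%N by rewrite index_mem.
have /matrixP/(_ (Ordinal lt_u) c) := mulmx_coker M.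
rewrite !mxE -hK ?lt_n1 ?inE ?uW ?orbT // => uK; rewrite -[RHS]uK.
by apply: eq_bigr => j _; rewrite [M _ _]mxE /= nth_index.
Qed.

End OddSpan.

(** * The power semiring of the group of order two *)

Section TwoGroup.

Import GroupScope.

Variable gT : finGroupType.
Hypothesis G2 : #|gT| = 2.

Local Notation PG := (power_algebra gT).

Lemma order2_group : exists a : gT,
  [/\ a != 1, a * a = 1 & forall g, g = 1 \/ g = a].
Proof.
have /cards2P[x [y [xy xyT]]] : #|[set: gT]| == 2 by rewrite cardsT G2.
have all_xy g : g = x \/ g = y.
  by have := in_setT g; rewrite xyT => /set2P.
have [a a1 aP] : exists2 a : gT, a != 1 & forall g, g = 1 \/ g = a.
  have [->|->] := all_xy 1; [exists y; rewrite 1?eq_sym // => g|exists x => // g].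
  by have [|] := all_xy g; [right|left].
exists a; split=> //; have [//|aa] := aP (a * a).
by case/eqP: a1; apply: (mulgI a); rewrite aa mulg1.
Qed.

Lemma power_two_basis e : List.In e two_basis -> satisfies PG e.
Proof.
have [a [a1 aa aP]] := order2_group.
have sq (g : gT) : g * g = 1 by have [->|->] := aP g; rewrite ?mulg1.
have gC (g h : gT) : g * h = h * g.
  by have [->|->] := aP g; have [->|->] := aP h; rewrite ?mulg1 ?mul1g.
have mulC : commutative (@mul_op PG).
  move=> X Y; apply: val_inj => /=; apply/setP=> g.
  by apply/mulsgP/mulsgP=> -[x y xX yY ->]; exists y x.
have square (X Y : PG) : add_op X (mul_op (mul_op X Y) Y) = mul_op (mul_op X Y) Y.
  apply: val_inj => /=; apply/setUidPr/subsetP=> x xX.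
  have /set0Pn[y yY] := valP (Y : nonempty_set gT).
  by rewrite -(mulg1 x) -(sq y) mulgA !mem_mulg.
have triple (X Y Z : PG) : add_op (mul_op (mul_op X Y) Z) (add_op (add_op X Y) Z)
    = add_op (add_op X Y) Z.
  apply: val_inj => /=; apply/setUidPr/subsetP=> _ /mulsgP[_ z /mulsgP[x y xX yY ->] zZ ->].
  (* Two of the three elements are equal and cancel, leaving the third. *)
  rewrite !inE; have [xy|yz|xz] : [\/ x = y, y = z | x = z].
    by have [->|->] := aP x; have [->|->] := aP y; have [->|->] := aP z; constructor.
  - by rewrite xy sq mul1g zZ orbT.
  - by rewrite yz -mulgA sq mulg1 xX.
  - by rewrite (gC x) -mulgA xz sq mulg1 yY orbT.
case=> [<- v|]; first exact: power_addA.
case=> [<- v|]; first exact: power_addC.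
case=> [<- v|]; first exact: power_addI.
case=> [<- v|]; first exact: power_mulA.
case=> [<- v|]; first exact: mulC.
case=> [<- v|]; first exact: power_mulDr.
case=> [<- v|]; first exact: square.
case=> [<- v|]; first exact: triple.
by [].
Qed.

Lemma power_two_covered p q : satisfies PG (p, q) ->
  forall w, w \in words q -> covered p w.
Proof.
move=> pq w wq; have [a [a1 aa aP]] := order2_group.
have pqv (v : nat -> PG) (g : gT) : g \in \prod_(i <- w) pset (v i) ->
    exists2 u, u \in words p & g \in \prod_(i <- u) pset (v i).
  move=> gw; have : g \in pset (eval v q) by apply/mem_eval_power; exists w.
  by rewrite -[eval v q](pq v) => /mem_eval_power.
split=> [|i iw].
  have [n1 n1P] := words_bound p; have [n2 n2P] := words_bound q.
  apply: (@odd_span _ _ (maxn n1 n2)) => [u|h].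
    rewrite inE => /predU1P[->|/n1P]; last by apply: all_gtn_leq; rewrite leq_maxl.
    by apply: all_gtn_leq (n2P _ wq); rewrite leq_maxr.
  (* Singletons of powers of [a] detect the parity of the exponent sum of a word. *)
  have neq0 i : [set a ^+ h i] != set0 by apply/set0Pn; exists (a ^+ h i); rewrite inE.
  pose v i : PG := exist _ [set a ^+ h i] (neq0 i).
  have prodv u : \prod_(i <- u) pset (v i) = [set a ^+ \sum_(i <- u) h i].
    elim: u => [|i u IHu]; first by rewrite !big_nil.
    by rewrite !big_cons IHu expgD mulg_set1.
  have [|u up] := pqv v (a ^+ \sum_(i <- w) h i); first by rewrite prodv set11.
  rewrite prodv => /set1P wu; exists u => //.
  have expa k : (a ^+ k == 1) = ~~ odd k.
    rewrite -{1}(odd_double_half k) -muln2 mulnC expgD expgM expgS expg1 aa expg1n mulg1.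
    by case: odd; rewrite ?expg1 ?eqxx // (negPf a1).
  by apply: negb_inj; rewrite -!expa wu.
(* With the whole group at [i] and 1 elsewhere, [a] lies in the value of a word only if [i] occurs
   in it. *)
have neq0 (j : nat) : (if j == i then [set: gT] else 1) != set0.
  by apply/set0Pn; exists 1; case: ifP; rewrite inE.
pose v j : PG := exist _ (if j == i then [set: gT] else 1) (neq0 j).
have prodv u : \prod_(j <- u) pset (v j) = if i \in u then [set: gT] else 1.
  elim: u => [|j u IHu]; first by rewrite big_nil.
  rewrite big_cons IHu inE /pset /= eq_sym; case: eqP => _ /=; last by rewrite mul1g.
  by case: ifP; rewrite ?mulg1 // mulGid.
have [|u up] := pqv v a; first by rewrite prodv iw inE.
by rewrite prodv; case: ifP => [iu _|_]; [exists u|rewrite inE (negPf a1)].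
Qed.

Lemma power_two_finitely_based : finitely_based PG.
Proof.
apply: (finitely_based_complete power_two_basis) => B BE p q pq v.
pose val3 (x y z : B) i := nth x [:: x; y; z] i.
have basis k x y z : k < size two_basis ->
    eval (val3 x y z) (nth (Var 0, Var 0) two_basis k).1 =
    eval (val3 x y z) (nth (Var 0, Var 0) two_basis k).2.
  by move=> lt_k; apply: BE; case: k lt_k => [|[|[|[|[|[|[|[|k]]]]]]]] //= _; tauto.
have le := covered_le (fun x y z => basis 0%N x y z isT) (fun x y => basis 1%N x y x isT)
  (fun x => basis 2%N x x x isT) (fun x y z => basis 3%N x y z isT)
  (fun x y => basis 4%N x y x isT) (fun x y z => basis 5%N x y z isT)
  (fun x y => basis 6%N x y x isT) (fun x y z => basis 7%N x y z isT).
have qp : satisfies PG (q, p) by move=> u; rewrite (pq u).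
rewrite /= -(le v p q (power_two_covered pq)).
have addC : commutative (@add_op B) := fun x y => basis 1%N x y x isT.
by rewrite addC (le v q p (power_two_covered qp)).
Qed.

End TwoGroup.

Theorem theorem1p2 (gT : finGroupType) :
  nonfinitely_based (power_semiring gT) <-> 3 <= #|gT|.
Proof.
split=> [nfb|]; last exact: power_nonfinitely_based.
rewrite ltnNge; apply/negP; rewrite leq_eqVlt => /predU1P[G2|G1].
  exact: nfb (power_two_finitely_based G2).
(* Over the trivial group the only nonempty subset is [[set 1]]. *)
apply: nfb; apply: finitely_based_trivial => X Y; apply: val_inj.
have G1' g : g = 1%g :> gT.
  by apply: (card_le1_eqP (A := gT)) => //.
have setE (Z : nonempty_set gT) : val Z = [set 1%g].
  have /set0Pn[z zZ] := valP Z; apply/setP=> g.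
  by rewrite (G1' g) inE eqxx -(G1' z).
by rewrite !setE.
Qed.
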